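(* Let $B\subset\mathbb{R}^n$ be the unit ball of a polyhedral norm. Let $X=\mathbb{V}(f)\subset\mathbb{R}^n$ be a smooth, pure codimension-one real algebraic variety and let $\mathcal{X}_B=\{X_i\}_{i=0}^{n-1}$ be its stratification with respect to $B$, where $X_i$ is the set of points $v\in X$ whose normal direction lies in the cone $C_F$ of some face $F\in\mathcal{F}_i$ of $B$. Then $X_i$ is a semialgebraic set for all $i=0,\dots,n-1$.
   Context: Polyhedral norm: let $\mathcal{L}$ be a finite set of linear functionals on $\mathbb{R}^n$ with $\mathcal{L}=-\mathcal{L}$ such that $B=\{x\in\mathbb{R}^n\mid \ell(x)\le 1 \text{ for all }\ell\in\mathcal{L}\}$ is a bounded, full-dimensional polytope (so $B=-B$). The polyhedral norm is $h(x)=\max_{\ell\in\mathcal{L}}\ell(x)$, with unit ball $B$. $\mathcal{F}$ is the set of proper nonempty faces of $B$, and $\mathcal{F}_i=\{F\in\mathcal{F}\mid\dim F=n-1-i\}$. For $F\in\mathcal{F}$, the inner normal open cone $C_F$ is the set of nonzero vectors $w$ such that $x\mapsto w^Tx$ attains its minimum over $B$ exactly on $F$. $\mathbb{V}(f)$ is the real zero set of $f\in\mathbb{R}[x_1,\dots,x_n]$. For $v\in X$, $N_v(X)$ is the one-dimensional normal space of $X$ at $v$. Precisely, $X_i=\{v\in X\mid N_v(X)\cap C_F\neq\emptyset\text{ for some }F\in\mathcal{F}_i\}$; equivalently, with $\varphi:\mathbb{R}^n\setminus\{0\}\to\mathbb{RP}^{n-1}$ the quotient map, $X_i$ is the preimage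 of $\bigcup_{F\in\mathcal{F}_i}\varphi(C_F)$ under the map sending $v$ to the class of $N_v(X)$ in $\mathbb{RP}^{n-1}$. *)

(* Defs.v *)
From mathcomp Require Import all_boot all_order all_algebra.
From mathcomp Require Import classical_sets reals.
From mathcomp Require Import mpoly.
Set Implicit Arguments.
Unset Strict Implicit.
Unset Printing Implicit Defensive.

Import Order.TTheory GRing.Theory Num.Theory.
Local Open Scope classical_set_scope.
Local Open Scope ring_scope.

(* Points of R^n are row vectors; the i-th coordinate of x is x 0 i. *)

Section LinearGeometry.
Variables (R : realType) (n : nat).
Implicit Types (x y u v w : 'rV[R]_n) (A B F S : set 'rV[R]_n).

Definition dot u v : R := \sum_(i < n) u 0 i * v 0 i.

Definition linspan A : set 'rV[R]_n :=
  [set u | forall W : {vspace 'rV[R]_n}, (forall x, A x -> x \in W) -> u \in W].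

(* S is a linear subspace of dimension d. *)
Definition has_dim S (d : nat) : Prop :=
  exists W : {vspace 'rV[R]_n}, S = [set u | u \in W] /\ \dim W = d.

Definition affdim A (d : nat) : Prop :=
  A !=set0 /\
  has_dim (linspan [set u | exists x y, [/\ A x, A y & u = x - y]]) d.

Definition coord_bounded A : Prop :=
  exists M : R, forall x, A x -> forall i, `|x 0 i| <= M.

Definition halfspaces_ball (L : seq 'Hom('rV[R]_n, R^o)) : set 'rV[R]_n :=
  [set x | forall l, l \in L -> (l x : R) <= 1].

(* The norm is x |-> max_(l in L) l x, whose unit ball is halfspaces_ball L. *)
Definition polyhedral_unit_ball B : Prop :=
  exists L : seq 'Hom('rV[R]_n, R^o),
    [/\ forall l, l \in L -> - l \in L,
        B = halfspaces_ball L,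
        coord_bounded B
      & affdim B n].

(* Taking w = 0 yields the improper faces B and the empty set. *)
Definition is_face B F : Prop :=
  exists w (c : R),
    (forall x, B x -> c <= dot w x) /\ F = [set x | B x /\ dot w x = c].

Definition proper_face B F : Prop := [/\ is_face B F, F !=set0 & F <> B].

Definition face_stratum B (i : nat) : set (set 'rV[R]_n) :=
  [set F | proper_face B F /\ affdim F (n - 1 - i)].

Definition inner_normal_cone B F : set 'rV[R]_n :=
  [set w | w != 0 /\
     F = [set x | B x /\ forall y, B y -> dot w x <= dot w y]].

End LinearGeometry.

Section AlgebraicSets.
Variables (R : realType) (n : nat).
Implicit Types (f g p : {mpoly R[n]}) (u v w : 'rV[R]_n).
Implicit Types (X Z Y : set 'rV[R]_n).

Definition real_zeros f : set 'rV[R]_n := [set x | f.@[x 0] = 0].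

Definition algebraic_set Z : Prop :=
  exists P : set {mpoly R[n]},
    Z = [set x | forall p, P p -> p.@[x 0] = 0].

Definition irreducible_set Z : Prop :=
  [/\ algebraic_set Z, Z !=set0
    & forall Y1 Y2, algebraic_set Y1 -> algebraic_set Y2 ->
        Z = Y1 `|` Y2 -> Z = Y1 \/ Z = Y2].

Definition irreducible_component X Z : Prop :=
  [/\ irreducible_set Z, Z `<=` X
    & forall Y, irreducible_set Y -> Z `<=` Y -> Y `<=` X -> Y = Z].

(* Z = C 0 < C 1 < ... < C c, strictly increasing irreducible sets in R^n. *)
Definition chain_above Z (c : nat) : Prop :=
  exists C : nat -> set 'rV[R]_n,
    [/\ C 0%N = Z,
        forall k, (k <= c)%N -> irreducible_set (C k)
      & forall k, (k < c)%N -> C k `<=` C k.+1 /\ C k <> C k.+1].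

Definition has_codim Z (c : nat) : Prop :=
  chain_above Z c /\ forall c', chain_above Z c' -> (c' <= c)%N.

Definition pure_codim X (c : nat) : Prop :=
  forall Z, irreducible_component X Z -> has_codim Z c.

Definition vanishing_ideal X : set {mpoly R[n]} :=
  [set g | forall x, X x -> g.@[x 0] = 0].

Definition gradient g v : 'rV[R]_n := \row_i (g^`M(i)).@[v 0].

(* Defined by all of I(X): an f with X = V(f) need not generate I(X), and its
   gradient may vanish on X (e.g. when f is a square). *)
Definition tangent_space X v : set 'rV[R]_n :=
  [set u | forall g, vanishing_ideal X g -> dot (gradient g v) u = 0].

Definition normal_space X v : set 'rV[R]_n :=
  [set w | forall u, tangent_space X v u -> dot w u = 0].

(* Jacobian criterion: at every point, the Zariski tangent space has the
   dimension n - c of X. *)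
Definition smooth_of_pure_codim X (c : nat) : Prop :=
  pure_codim X c /\ forall v, X v -> has_dim (tangent_space X v) (n - c).

Definition polyhedral_stratum B X (i : nat) : set 'rV[R]_n :=
  [set v | X v /\ exists2 F, face_stratum B i F
                           & normal_space X v `&` inner_normal_cone B F !=set0].

Definition basic_semialgebraic (E P : seq {mpoly R[n]}) : set 'rV[R]_n :=
  [set x | (forall p, p \in E -> p.@[x 0] = 0) /\
           (forall p, p \in P -> 0 < p.@[x 0])].

Definition semialgebraic (S : set 'rV[R]_n) : Prop :=
  exists D : seq (seq {mpoly R[n]} * seq {mpoly R[n]}),
    S = [set x | exists2 d, d \in D & basic_semialgebraic d.1 d.2 x].

End AlgebraicSets.

(* Main.v *)
(* By smoothness the normal space at v is a line, spanned by the gradient of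
   some polynomial of I(X) that is nonzero at v. As I(X) is finitely generated,
   finitely many gradients suffice for all v. Since B is the convex hull of
   finitely many points, the face on which w is minimal is determined by the set
   of these points at which w is minimal; prescribing this set for a gradient
   or its opposite is a finite system of polynomial equations and strict
   inequalities in v. *)
Require Import Defs.
From mathcomp Require Import all_boot all_order all_algebra.
From mathcomp Require Import boolp classical_sets reals.
From mathcomp Require Import mpoly.
From mathcomp Require Import ring lra.
Set Implicit Arguments.
Unset Strict Implicit.
Unset Printing Implicit Defensive.

Import Order.TTheory GRing.Theory Num.Theory.

(** * Bounded polyhedra as convex hulls, and their faces as sets of minimizers *)

Section Polytopes.
Local Open Scope classical_set_scope.
Local Open Scope ring_scope.
Variables (R : realType) (n : nat).
Implicit Types (u v w x y : 'rV[R]_n).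

Lemma dotDr w x y : dot w (x + y) = dot w x + dot w y.
Proof.
by rewrite /dot -big_split; apply: eq_bigr => i _; rewrite mxE mulrDr.
Qed.

Lemma dotZr (c : R) w x : dot w (c *: x) = c * dot w x.
Proof.
by rewrite /dot mulr_sumr; apply: eq_bigr => i _; rewrite mxE mulrCA.
Qed.

Lemma dotC w x : dot w x = dot x w.
Proof. by apply: eq_bigr => i _; rewrite mulrC. Qed.

Lemma dotZl (c : R) w x : dot (c *: w) x = c * dot w x.
Proof. by rewrite dotC dotZr dotC. Qed.

Lemma dot0r w : dot w 0 = 0.
Proof. by rewrite -(scale0r 0) dotZr mul0r. Qed.

Lemma dot0l w : dot 0 w = 0.
Proof. by rewrite dotC dot0r. Qed.

Lemma dotNr w x : dot w (- x) = - dot w x.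
Proof. by rewrite -scaleN1r dotZr mulN1r. Qed.

Lemma dot_sumr (J : finType) w (c : J -> R) (V : J -> 'rV[R]_n) :
  dot w (\sum_j c j *: V j) = \sum_j c j * dot w (V j).
Proof.
rewrite (big_morph (dot w) (dotDr w) (dot0r w)).
by apply: eq_bigr => j _; rewrite dotZr.
Qed.

Lemma dot_eq0 w : dot w w = 0 -> w = 0.
Proof.
move=> w0; apply/rowP => i; rewrite mxE.
have /(_ i isT)/eqP := psumr_eq0P (fun i _ => sqr_ge0 (w 0 i)) w0.
by rewrite sqrf_eq0 => /eqP.
Qed.

Definition weights (J : finType) (c : J -> R) : Prop :=
  (forall j, 0 <= c j) /\ \sum_j c j = 1.

Definition hull (J : finType) (V : J -> 'rV[R]_n) : set 'rV[R]_n :=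
  [set x | exists2 c, weights c & x = \sum_j c j *: V j].

Lemma hull_vertex (J : finType) (V : J -> 'rV[R]_n) j : hull V (V j).
Proof.
exists (fun k => (k == j)%:R).
  split=> [k|]; first exact: ler0n.
  by rewrite (bigD1 j)//= eqxx big1 ?addr0// => k /negPf ->.
rewrite (bigD1 j)//= eqxx scale1r big1 ?addr0// => k /negPf ->.
by rewrite scale0r.
Qed.

Lemma hull_segment (J : finType) (V : J -> 'rV[R]_n) (t : R) x y :
  0 <= t <= 1 -> hull V x -> hull V y -> hull V (t *: x + (1 - t) *: y).
Proof.
case/andP=> t0 t1 [c [c0 c1] ->] [d [d0 d1] ->].
exists (fun j => t * c j + (1 - t) * d j).
  split=> [j|]; first by rewrite addr_ge0// mulr_ge0// subr_ge0.
  by rewrite big_split -!mulr_sumr /= c1 d1; ring.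
rewrite !scaler_sumr -big_split; apply: eq_bigr => j _ /=.
by rewrite !scalerA -scalerDl.
Qed.

Definition polyhedron (I : finType) (a : I -> 'rV[R]_n) : set 'rV[R]_n :=
  [set x | forall i, dot (a i) x <= 1].

(** A finite function, so that active sets form a finite type, which can index the points of a
    hull. *)
Definition active (I : finType) (a : I -> 'rV[R]_n) x : {ffun I -> bool} :=
  [ffun i => dot (a i) x == 1].

(** Along [u] the active constraints stay tight; boundedness makes some other constraint tight after
    a finite time, and [t] is the first such time. *)
Lemma exit_point (I : finType) (a : I -> 'rV[R]_n) x u :
    coord_bounded (polyhedron a) -> polyhedron a x -> u != 0 ->
    (forall i, active a x i -> dot (a i) u = 0) ->
  exists t : R, [/\ 0 < t, polyhedron a (x + t *: u)
    & (#|[pred i | active a x i]| < #|[pred i | active a (x + t *: u) i]|)%N].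
Proof.
case=> M bM Bx un0 kill.
have [/existsP[i0 i0u]|/existsPn noexit] :=
  boolP [exists i, 0 < dot (a i) u]; last first.
  have Bt t : 0 <= t -> polyhedron a (x + t *: u).
    move=> t0 i; rewrite dotDr dotZr (le_trans _ (Bx i))// gerDl.
    by rewrite mulr_ge0_le0// leNgt noexit.
  have [k uk] := rV0Pn _ un0.
  have uk0 : 0 < `|u 0 k| by rewrite normr_gt0.
  have M0 : 0 <= M by rewrite (le_trans _ (bM _ Bx k)).
  (* Chosen so that [t * u 0 k] has absolute value [M + |x 0 k| + 1], one more than boundedness
     allows. *)
  pose t := (M + `|x 0 k| + 1) / `|u 0 k|.
  have t0 : 0 <= t by rewrite divr_ge0// addr_ge0// addr_ge0.
  have := bM _ (Bt _ t0) k; rewrite !mxE => le1.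
  have : `|t * u 0 k| <= M + `|x 0 k|.
    rewrite -[t * _](addKr (x 0 k)) (le_trans (ler_normD _ _))// normrN addrC.
    by rewrite lerD2r.
  rewrite normrM (ger0_norm t0) /t divfK ?gt_eqF// => ?; lra.
(* The time at which constraint [i] becomes tight, meaningful when it increases along [u]. *)
pose T i := (1 - dot (a i) x) / dot (a i) u.
case: (@arg_minP _ _ _ i0 (fun i => 0 < dot (a i) u) T i0u) => i1 i1u Tmin.
have nact i : 0 < dot (a i) u -> dot (a i) x < 1.
  move=> iu; rewrite lt_neqAle Bx andbT; apply: contraTneq iu => ix.
  by rewrite kill ?ltxx// ffunE ix.
exists (T i1); split.
- by rewrite divr_gt0// subr_gt0 nact.
- move=> i; rewrite dotDr dotZr.
  have [iu|iu] := ltP 0 (dot (a i) u).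
    by have := Tmin i iu; rewrite ler_pdivlMr// -lerBrDl.
  rewrite (le_trans _ (Bx i))// gerDl mulr_ge0_le0//.
  by rewrite divr_ge0 ?ltW// subr_gt0 nact.
- apply: proper_card; apply/properP; split.
    apply/fintype.subsetP => i; rewrite !inE => ai; rewrite ffunE dotDr dotZr kill//.
    by rewrite mulr0 addr0; move: ai; rewrite ffunE.
  exists i1; rewrite !inE ffunE.
    by rewrite dotDr dotZr /T divfK ?lt0r_neq0// addrC subrK.
  by rewrite lt_eqF// nact.
Qed.

(* A point whose active constraints leave a direction free lies between two
   points with strictly more active constraints; a point with no free direction
   is determined by its active set, so there are finitely many of these. *)
Lemma polytope_hull (I : finType) (a : I -> 'rV[R]_n) :
    coord_bounded (polyhedron a) ->
  exists V : {ffun I -> bool} -> 'rV[R]_n, polyhedron a = hull V.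
Proof.
move=> bB.
pose rigid x := forall u, (forall i, active a x i -> dot (a i) u = 0) -> u = 0.
(* The default 0 satisfies every constraint, so the hull stays inside the polyhedron. *)
pose V S := xget 0 [set x | [/\ polyhedron a x, active a x = S & rigid x]].
exists V; apply/seteqP; split=> x; last first.
  case=> c [c0 c1] -> i; rewrite dot_sumr -c1; apply: ler_sum => S _.
  rewrite ler_piMr// /V; case: xgetP => [y _ [/(_ i)]//|_].
  by rewrite dot0r.
(* Induction on the number of inactive constraints. *)
have [k] := ubnP (#|I| - #|[pred i | active a x i]|)%N.
elim: k x => // k IH x; rewrite ltnS => le_k Bx.
have closer y : polyhedron a y ->
    (#|[pred i | active a x i]| < #|[pred i | active a y i]|)%N -> hull V y.
  move=> By lt_xy; apply: IH => //; apply: leq_trans le_k.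
  by rewrite ltn_sub2l// (leq_trans lt_xy)// max_card.
have [rx|/existsNP[u /not_implyP[kill /eqP un0]]] := pselect (rigid x).
  suff -> : x = V (active a x) by exact: hull_vertex.
  rewrite /V; case: xgetP => [y _ [By ay ry]|/(_ x)[]//].
  apply/eqP; rewrite -subr_eq0; apply/eqP; apply: rx => i ai.
  have yi : active a y i by rewrite ay.
  move: ai yi; rewrite !ffunE => /eqP xi /eqP yi.
  by rewrite dotDr dotNr xi yi subrr.
have [t [t0 Bt lt_t]] := exit_point bB Bx un0 kill.
have Nun0 : - u != 0 by rewrite oppr_eq0.
have Nkill i : active a x i -> dot (a i) (- u) = 0.
  by move=> /kill; rewrite dotNr => ->; rewrite oppr0.
have [s [s0 Bs lt_s]] := exit_point bB Bx Nun0 Nkill.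
have ts0 : 0 < s + t by rewrite addr_gt0.
(* With these weights the displacements [t *: u] and [s *: - u] cancel. *)
have -> : x = (s / (s + t)) *: (x + t *: u) +
              (1 - s / (s + t)) *: (x + s *: - u).
  apply/rowP => k'; rewrite !mxE; field; exact: lt0r_neq0.
apply: hull_segment; [|exact: closer..].
by rewrite ler_pdivrMr// mul1r lerDl (ltW t0) andbT divr_ge0// ltW.
Qed.

Definition argmins (J : finType) (b : J -> R) : {ffun J -> bool} :=
  [ffun j => [forall k, b j <= b k]].

(** Comparison with one index known to be in [S] turns minimality into equations and strict
    inequalities, the form of a basic semialgebraic set. *)
Lemma argminsP (J : finType) (b : J -> R) (S : {ffun J -> bool}) j0 : S j0 ->
  argmins b = S <-> (forall j, S j -> b j = b j0) /\
                    (forall j, ~~ S j -> b j0 < b j).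
Proof.
move=> Sj0; split=> [argS|[eqS ltS]].
  move: Sj0; rewrite -argS => Sj0.
  have min0 k : b j0 <= b k by move: Sj0; rewrite ffunE => /forallP.
  split=> j; rewrite ffunE.
    by move=> /forallP/(_ j0) ?; apply/eqP; rewrite eq_le min0 andbT.
  by rewrite negb_forall => /existsP[k]; rewrite -ltNge; apply: le_lt_trans.
apply/ffunP => j; rewrite ffunE; have [Sj|/negPf Sj] := boolP (S j).
  apply/forallP => k; rewrite (eqS j Sj).
  by have [/eqS ->|/ltS/ltW] := boolP (S k).
by apply/negbTE/forallPn; exists j0; rewrite -ltNge ltS// Sj.
Qed.

Lemma argmins_exists (J : finType) (b : J -> R) (j0 : J) :
  exists j, argmins b j.
Proof.
case: (@arg_minP _ _ _ j0 xpredT b isT) => j _ bj.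
by exists j; rewrite ffunE; apply/forallP => k; apply: bj.
Qed.

Lemma argminsZ (J : finType) (c : R) (b : J -> R) :
  0 < c -> argmins (fun j => c * b j) = argmins b.
Proof.
move=> c0; apply/ffunP => j; rewrite !ffunE.
by apply: eq_forallb => k; rewrite ler_pM2l.
Qed.

Definition minimizers (B : set 'rV[R]_n) w : set 'rV[R]_n :=
  [set x | B x /\ forall y, B y -> dot w x <= dot w y].

(** The value of [w] at a convex combination averages its values at the points [V j], so it is
    minimal exactly when no weight falls on a non-minimizing index. The right-hand side sees [w]
    only through [argmins]. *)
Lemma minimizers_hull (J : finType) (V : J -> 'rV[R]_n) (j0 : J) w :
  minimizers (hull V) w =
  [set x | exists2 c, weights c /\
      (forall j, ~~ argmins (fun j => dot w (V j)) j -> c j = 0)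
      & x = \sum_j c j *: V j].
Proof.
have [j1 min1] := argmins_exists (fun j => dot w (V j)) j0.
have [eq1 lt1] := (argminsP (fun j => dot w (V j)) min1).1 erefl.
have le1 j : dot w (V j1) <= dot w (V j).
  by move: min1; rewrite ffunE => /forallP.
apply/seteqP; split=> x.
  case=> -[c [c0 c1] ->] /(_ _ (hull_vertex V j1)) lex; exists c => //.
  split=> // j jmin.
  (* The excess of [x] over the minimum: a sum of nonnegative terms that is zero, so each term
     is. *)
  have : \sum_j c j * (dot w (V j) - dot w (V j1)) = 0.
    apply/eqP; rewrite eq_le; apply/andP; split; last first.
      by apply: sumr_ge0 => k _; rewrite mulr_ge0// subr_ge0.
    under eq_bigr do rewrite mulrBr.
    by rewrite sumrB -mulr_suml c1 mul1r subr_le0 -dot_sumr.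
  move/psumr_eq0P => /(_ (fun k _ => mulr_ge0 (c0 k) _)).
  move=> /(_ _ j isT)/eqP; rewrite mulf_eq0 subr_eq0 => /(_ _)/orP[].
    by move=> k; rewrite subr_ge0.
  - by move/eqP.
  - by rewrite gt_eqF// lt1.
case=> c [[c0 c1] cmin] ->; split; first by exists c.
move=> y [d [d0 d1] ->].
have -> : dot w (\sum_j c j *: V j) = dot w (V j1).
  rewrite dot_sumr -[RHS]mul1r -c1 mulr_suml; apply: eq_bigr => j _.
  have [/eq1 ->//|/cmin ->] := boolP (argmins (fun j => dot w (V j)) j).
  by rewrite !mul0r.
rewrite dot_sumr -[leLHS]mul1r -d1 mulr_suml; apply: ler_sum => j _.
by rewrite ler_wpM2l.
Qed.

Lemma functional_dot (l : 'Hom('rV[R]_n, R^o)) x :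
  (l x : R) = dot (\row_i (l (delta_mx 0 i) : R)) x.
Proof.
rewrite {1}(row_sum_delta x) linear_sum; apply: eq_bigr => i _.
by rewrite linearZ mxE mulrC.
Qed.

Lemma polyhedral_unit_ball_hull (B : set 'rV[R]_n) : polyhedral_unit_ball B ->
  exists (J : finType) (V : J -> 'rV[R]_n) (j0 : J), B = hull V.
Proof.
case=> L [_ defB bB _].
pose a (i : 'I_(size L)) := \row_k (tnth (in_tuple L) i (delta_mx 0 k) : R).
have BE : B = polyhedron a.
  rewrite defB; apply/seteqP; split=> x Bx.
    by move=> i; rewrite -functional_dot; apply: Bx; apply: mem_tnth.
  move=> l /(@tnthP _ _ (in_tuple L))[i ->].
  by rewrite functional_dot; apply: Bx.
rewrite BE in bB *; have [V ->] := polytope_hull bB.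
by exists _, V, [ffun => false].
Qed.

End Polytopes.

(** * Finitely many gradients that detect the whole vanishing ideal *)

Section GradientDetection.
Local Open Scope classical_set_scope.
Local Open Scope ring_scope.

(* Dickson's lemma, by induction on the number of coordinates compared. *)
Lemma dickson (T : eqType) (n : nat) (e : T -> 'X_{1..n}) (M : set T) :
  exists s : seq T, (forall t, t \in s -> M t) /\
    forall t, M t -> exists2 t', t' \in s & (e t' <= e t)%MM.
Proof.
suff H k (N : set T) : exists s : seq T, (forall t, t \in s -> N t) /\
    forall t, N t -> exists2 t', t' \in s &
      forall i : 'I_n, (i < k)%N -> (e t' i <= e t i)%N.
  have [s [sM Ms]] := H n M; exists s; split=> // t /Ms[t' st' le_t].
  by exists t' => //; apply/mnm_lepP => i; apply: le_t.
elim: k N => [|k IH] N.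
  have [[t Nt]|N0] := pselect (exists t, N t).
    exists [:: t]; split=> [_ /[!inE]/eqP->//|t' _].
    by exists t => //; rewrite inE.
  by exists [::]; split=> // t Nt; case: N0; exists t.
have [kn|nk] := ltnP k n; last first.
  have [s [sN Ns]] := IH N; exists s; split=> // t /Ns[t' st' le_t].
  by exists t' => // i _; apply: le_t; apply: leq_trans nk.
pose o := Ordinal kn.
have [s0 [s0N Ns0]] := IH N.
(* [b] bounds coordinate [o] over [s0], so [s0] serves every [t] with [e t o >= b]; only the smaller
   values remain, treated one at a time. *)
pose b := (\sum_(t <- s0) e t o)%N.
suff [s [sN Ns]] : exists s : seq T, (forall t, t \in s -> N t) /\
    forall t, N t -> (e t o < b)%N -> exists2 t', t' \in s &
      forall i : 'I_n, (i < k.+1)%N -> (e t' i <= e t i)%N.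
  exists (s0 ++ s); split=> [t|t Nt].
    by rewrite mem_cat => /orP[/s0N|/sN].
  have [lt_b|le_b] := ltnP (e t o) b.
    have [t' st' le_t] := Ns t Nt lt_b.
    by exists t' => //; rewrite mem_cat st' orbT.
  have [t' st' le_t] := Ns0 t Nt; exists t'; first by rewrite mem_cat st'.
  move=> i; rewrite ltnS leq_eqVlt => /predU1P[ik|]; last exact: le_t.
  have -> : i = o by apply: val_inj.
  by rewrite (leq_trans _ le_b)// /b (big_rem t')//= leq_addr.
elim: b => [|b [s [sN Ns]]]; first by exists [::].
(* Among elements with [e t o = b], comparing the first [k] coordinates is enough. *)
have [s' [s'N Ns']] := IH [set t | N t /\ e t o = b].
exists (s' ++ s); split=> [t|t Nt].
  by rewrite mem_cat => /orP[/s'N[]|/sN].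
rewrite ltnS leq_eqVlt => /predU1P[eb|lt_b]; last first.
  have [t' st' le_t] := Ns t Nt lt_b.
  by exists t' => //; rewrite mem_cat st' orbT.
have [//|t' st' le_t] := Ns' t; exists t'; first by rewrite mem_cat st'.
move=> i; rewrite ltnS leq_eqVlt => /predU1P[ik|]; last exact: le_t.
have -> : i = o by apply: val_inj.
by rewrite eb; have [_ ->] := s'N _ st'.
Qed.

(* The [gs] generate the ideal: division by an element with dividing leading
   monomial changes the gradient on X only by a multiple of its gradient. *)
Lemma gradient_generators (R : realType) (n : nat) (X : set 'rV[R]_n) :
  exists gs : seq {mpoly R[n]},
    (forall g, g \in gs -> vanishing_ideal X g) /\
    forall v, X v -> (forall g, g \in gs -> gradient g v = 0) ->
      forall p, vanishing_ideal X p -> gradient p v = 0.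
Proof.
have [gs [gsI Igs]] := dickson (@mlead n R)
  [set p | p != 0 /\ vanishing_ideal X p].
exists gs; split=> [g /gsI[]//|v Xv gs0].
elim/mleadrect => p IH Ip.
have grad0 : gradient (0 : {mpoly R[n]}) v = 0.
  by apply/rowP => i; rewrite !mxE mderiv0 meval0.
have [->//|p0] := eqVneq p 0.
have [g sg le_g] := Igs p (conj p0 Ip).
have [g0 Ig] := gsI g sg.
(* [h * g] gets the leading term of [p], so [q] is zero or has a smaller leading monomial. *)
pose m := (mlead p - mlead g)%MM; pose c := mleadc p / mleadc g.
pose h : {mpoly R[n]} := c *: 'X_[m]; pose q := p - h * g.
have Iq : vanishing_ideal X q.
  by move=> x Xx; rewrite mevalB mevalM Ip// Ig// mulr0 subrr.
have lc0 (r : {mpoly R[n]}) : r != 0 -> mleadc r != 0 by rewrite mleadc_eq0.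
have c0 : c != 0 by rewrite mulf_neq0 ?invr_eq0 ?lc0.
have lead_h : mlead h = m by rewrite mleadZ// mleadXm.
have h0 : h != 0.
  by rewrite -mleadc_eq0 lead_h mcoeffZ mcoeffX eqxx mulr1.
have lead_hg : mlead (h * g) = mlead p by rewrite mleadM// lead_h submK.
have leadc_hg : (h * g)@_(mlead p) = mleadc p.
  rewrite -[in LHS]lead_hg mleadM// mleadcM lead_h mcoeffZ mcoeffX eqxx mulr1.
  by rewrite divfK// lc0.
have grad_q : gradient q v = 0.
  have [->//|q0] := eqVneq q 0; apply: IH => //.
  rewrite lt_neqAle; apply/andP; split.
    apply: contraNneq q0 => eq_lead.
    by rewrite -mleadc_eq0 eq_lead mcoeffB leadc_hg subrr.
  by rewrite (le_trans (mleadB_le _ _))// lead_hg joinxx.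
have -> : p = q + h * g by rewrite subrK.
(* At [v] both [g] and its gradient vanish, so by the product rule the gradient of [h * g] does
   too. *)
apply/rowP => i; move: grad_q (gs0 g sg) => /rowP/(_ i) + /rowP/(_ i).
rewrite !mxE mderivD mevalD mderivM mevalD !mevalM => -> ->.
by rewrite Ig// !mulr0 !addr0.
Qed.

End GradientDetection.

(** * The normal space as the line spanned by a nonzero gradient *)

Section NormalLine.
Local Open Scope classical_set_scope.
Local Open Scope ring_scope.
Variables (R : realType) (n : nat).
Implicit Types (X : set 'rV[R]_n) (v w : 'rV[R]_n).

Lemma gradient_normal X v g (c : R) :
  vanishing_ideal X g -> normal_space X v (c *: gradient g v).
Proof. by move=> Ig u /(_ g Ig) gu; rewrite dotZl gu mulr0. Qed.

(** The tangent hyperplane and the gradient span the space. Subtracting from [w] its projection to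
    the gradient leaves a vector of the hyperplane, to which [w] and the gradient are orthogonal, so
    it is orthogonal to itself. *)
Lemma normal_space_line X v g w :
    has_dim (tangent_space X v) (n - 1) -> vanishing_ideal X g ->
    gradient g v != 0 -> normal_space X v w ->
  exists c : R, w = c *: gradient g v.
Proof.
case=> W [TW dimW] Ig; set w0 := gradient g v => w0n Nw.
have w00 : dot w0 w0 != 0 by apply: contra_neq w0n; apply: dot_eq0.
have n0 : (0 < n)%N.
  by case: (n) w0 w0n {w00} => // w0; rewrite thinmx0 eqxx.
have orthW u : u \in W -> dot w0 u = 0.
  by move=> Wu; have : tangent_space X v u by [rewrite TW]; apply.
have full : (W + <[w0]>)%VS = fullv.
  apply/eqP; rewrite eqEdim subvf dimvf /dim /= mul1n dimv_disjoint_sum.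
    by rewrite dim_vline w0n dimW subnK.
  apply/eqP; rewrite -subv0; apply/subvP => u /memv_capP[Wu /vlineP[c uc]].
  have /eqP := orthW u Wu; rewrite uc dotZr mulf_eq0 (negPf w00) orbF.
  by move=> /eqP ->; rewrite scale0r mem0v.
pose c := dot w w0 / dot w0 w0; exists c.
pose r := w - c *: w0.
have r0 : dot w0 r = 0.
  by rewrite dotDr dotNr dotZr divfK// dotC subrr.
have /memv_addP[a Wa [_ /vlineP[d ->] rE]] : r \in (W + <[w0]>)%VS.
  by rewrite full memvf.
have d0 : d = 0.
  move: r0; rewrite rE dotDr orthW// add0r dotZr => /eqP.
  by rewrite mulf_eq0 (negPf w00) orbF => /eqP.
have Wr : r \in W by rewrite rE d0 scale0r addr0.
apply/eqP; rewrite -subr_eq0 -/r; apply/eqP/dot_eq0.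
have wr : dot w r = 0 by apply: Nw; rewrite TW.
by rewrite {1}/r dotC dotDr dotNr dotZr [dot r w]dotC wr [dot r w0]dotC r0; lra.
Qed.

(** Otherwise every gradient of the ideal vanishes at [v] and the tangent space has dimension [n],
    which differs from the truncated [n - 1] because [n > 0]. *)
Lemma gradient_neq0 X v (gs : seq {mpoly R[n]}) : (0 < n)%N ->
    has_dim (tangent_space X v) (n - 1) ->
    ((forall g, g \in gs -> gradient g v = 0) ->
       forall p, vanishing_ideal X p -> gradient p v = 0) ->
  exists2 g, g \in gs & gradient g v != 0.
Proof.
move=> n0 [W [TW dimW]] gsX.
apply/hasP; apply: contraT => /hasPn gs0.
have WT : W = fullv.
  apply/eqP; rewrite eqEsubv subvf; apply/subvP => u _.
  suff : tangent_space X v u by rewrite TW.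
  move=> p Ip; rewrite gsX// ?dot0l// => g /gs0; rewrite negbK.
  by move/eqP.
move: dimW; rewrite WT dimvf /dim /= mul1n => /eqP.
by rewrite -[eqbLHS](subnK n0) addn1 gtn_eqF.
Qed.

End NormalLine.

(** * Semialgebraic sets: finite unions and argmin conditions *)

Section Semialgebraic.
Local Open Scope classical_set_scope.
Local Open Scope ring_scope.
Variables (R : realType) (n : nat).
Implicit Types (S : set 'rV[R]_n).

Lemma semialgebraic_exists (T : eqType) (s : seq T) (S : T -> set 'rV[R]_n) :
  (forall t, semialgebraic (S t)) ->
  semialgebraic [set x | exists2 t, t \in s & S t x].
Proof.
move=> SS; elim: s => [|t s [D DE]].
  by exists [::]; apply/seteqP; split=> x [].
have [D' D'E] := SS t.
exists (D' ++ D); apply/seteqP; split=> x.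
  case=> t' /[!inE]/predU1P[->|st'] Sx.
    by move: Sx; rewrite D'E => -[d dD ?]; exists d => //; rewrite mem_cat dD.
  have : [set x | exists2 t, t \in s & S t x] x by exists t'.
  by rewrite DE => -[d dD ?]; exists d => //; rewrite mem_cat dD orbT.
case=> d; rewrite mem_cat => /orP[] dD xd.
  by exists t; rewrite ?mem_head// D'E; exists d.
have : [set x | exists2 t, t \in s & S t x] x by rewrite DE; exists d.
by case=> t' st' ?; exists t' => //; rewrite inE st' orbT.
Qed.

(** [P] does not involve the point, so the set is [S] or empty. This handles the condition that a
    face belongs to the stratum. *)
Lemma semialgebraic_when (P : Prop) S :
  semialgebraic S -> semialgebraic [set x | P /\ S x].
Proof.
move=> SS; have [p|np] := pselect P.
  by have -> : [set x | P /\ S x] = S by apply/seteqP; split=> x => [[]|].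
by exists [::]; apply/seteqP; split=> x [].
Qed.

Lemma semialgebraic_argmins (J : finType) (f : {mpoly R[n]})
    (q : J -> {mpoly R[n]}) (T : {ffun J -> bool}) (j0 : J) :
  semialgebraic [set x | f.@[x 0] = 0 /\ argmins (fun j => (q j).@[x 0]) = T].
Proof.
(* Minimizing indices exist because [j0] inhabits [J], so an empty [T] gives the empty set. *)
have [/existsP[j1 Tj1]|/existsPn T0] := boolP [exists j, T j]; last first.
  exists [::]; apply/seteqP; split=> x [] // _ argT.
  have [j] := argmins_exists (fun j => (q j).@[x 0]) j0.
  by rewrite argT (negPf (T0 j)).
exists [:: (f :: [seq q j - q j1 | j <- enum J & T j],
            [seq q j - q j1 | j <- enum J & ~~ T j])].
apply/seteqP; split=> x.
  case=> fx /(argminsP _ Tj1)[eqT ltT]; eexists; first exact: mem_head.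
  split=> p /=.
    rewrite inE => /predU1P[->//|/mapP[j]]; rewrite mem_filter => /andP[Tj _ ->].
    by rewrite mevalB eqT// subrr.
  move=> /mapP[j]; rewrite mem_filter => /andP[Tj _ ->].
  by rewrite mevalB subr_gt0 ltT.
case=> d /[!inE]/eqP-> /= [E P]; split; first by apply: E; rewrite mem_head.
apply/(argminsP _ Tj1); split=> j Tj.
  apply/eqP; rewrite -subr_eq0 -mevalB; apply/eqP/E; rewrite inE; apply/orP.
  by right; apply/mapP; exists j; rewrite // mem_filter Tj mem_enum.
rewrite -subr_gt0 -mevalB; apply: P.
by apply/mapP; exists j; rewrite // mem_filter Tj mem_enum.
Qed.

End Semialgebraic.

(** * The strata in terms of finitely many gradients and argmin sets *)

Section Strata.
Local Open Scope classical_set_scope.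
Local Open Scope ring_scope.
Variables (R : realType) (n : nat).

Definition gradient_dot (s : R) (V : 'rV[R]_n) (g : {mpoly R[n]}) :=
  \sum_i (s * V 0 i) *: g^`M(i).

Lemma gradient_dotE s V g (v : 'rV[R]_n) :
  (gradient_dot s V g).@[v 0] = dot (s *: gradient g v) V.
Proof.
rewrite /gradient_dot raddf_sum; apply: eq_bigr => i _ /=.
by rewrite mevalZ !mxE; ring.
Qed.

(* The face of the hull minimizing w depends only on the set of vertices
   minimizing w, so membership of v in the stratum depends only on the sets of
   vertices minimizing the two vectors [+/- gradient g v]. *)
Lemma polyhedral_stratum_hull (J : finType) (V : J -> 'rV[R]_n) (j0 : J)
    (X : set 'rV[R]_n) (gs : seq {mpoly R[n]}) (i : 'I_n) :
    (forall v, X v -> has_dim (tangent_space X v) (n - 1)) ->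
    (forall g, g \in gs -> vanishing_ideal X g) ->
    (forall v, X v -> (forall g, g \in gs -> gradient g v = 0) ->
       forall p, vanishing_ideal X p -> gradient p v = 0) ->
  polyhedral_stratum (hull V) X i =
  [set v | exists2 T, T \in enum {ffun J -> bool} &
           exists2 g, g \in gs &
           exists2 s, s \in [:: 1; -1 : R] &
             (exists2 w, face_stratum (hull V) i (minimizers (hull V) w)
                       & argmins (fun j => dot w (V j)) = T) /\
             X v /\ argmins (fun j => (gradient_dot s (V j) g).@[v 0]) = T].
Proof.
move=> dimT gsI gsX.
have gradE s g (v : 'rV[R]_n) : argmins (fun j => (gradient_dot s (V j) g).@[v 0]) =
    argmins (fun j => dot (s *: gradient g v) (V j)).
  by congr argmins; apply: funext => j; rewrite gradient_dotE.
apply/seteqP; split=> v.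
  case=> Xv [F stF [w [Nw [w0 FE]]]].
  have [g sg g0] := gradient_neq0 (leq_trans (ltn0Sn _) (ltn_ord i))
    (dimT v Xv) (gsX v Xv).
  have [c wE] := normal_space_line (dimT v Xv) (gsI g sg) g0 Nw.
  have c0 : c != 0 by apply: contraNneq w0 => c0; rewrite wE c0 scale0r.
  exists (argmins (fun j => dot w (V j))); first by rewrite mem_enum.
  (* [c] is [|c|] times its sign, and a positive factor leaves [argmins] unchanged. *)
  exists g => //; exists (Num.sg c).
    by rewrite !inE; case: (sgrP c) c0; rewrite ?eqxx ?orbT.
  split; first by exists w => //; rewrite /minimizers -FE.
  split=> //; rewrite gradE.
  have nc0 : 0 < `|c| by rewrite normr_gt0.
  rewrite -(argminsZ _ nc0); congr argmins; apply: funext => j.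
  by rewrite wE !dotZl mulrA [_ * Num.sg c]mulrC -numEsg.
(* [w'] may differ from the signed gradient, but equal [argmins] give equal faces. *)
case=> T _ [g sg [s _ [[w' stF wT] [Xv]]]]; rewrite gradE => gT.
split=> //; exists (minimizers (hull V) w') => //.
exists (s *: gradient g v); split; first exact: gradient_normal (gsI g sg).
have minE : minimizers (hull V) w' = minimizers (hull V) (s *: gradient g v).
  by rewrite !(minimizers_hull V j0) wT gT.
split=> //; have [[_ _ FB] _] := stF.
(* The zero vector is minimal on the whole hull, whereas the face is proper. *)
apply/eqP => w0; apply: FB; rewrite minE w0.
by apply/seteqP; split=> x => [[]//|Bx]; split=> // y _; rewrite !dot0l.
Qed.

End Strata.

Theorem theorem4p8 (R : realType) (n : nat) (B : set 'rV[R]_n)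
    (hB : polyhedral_unit_ball B) (f : {mpoly R[n]})
    (hX : smooth_of_pure_codim (real_zeros f) 1) :
  forall i : 'I_n, semialgebraic (polyhedral_stratum B (real_zeros f) i).
Proof.
move=> i; have [_ dimT] := hX.
have [J [V [j0 ->]]] := polyhedral_unit_ball_hull hB.
have [gs [gsI gsX]] := gradient_generators (real_zeros f).
rewrite (polyhedral_stratum_hull V j0 i dimT gsI gsX).
apply: semialgebraic_exists => T; apply: semialgebraic_exists => g.
apply: semialgebraic_exists => s; apply: semialgebraic_when.
exact: semialgebraic_argmins.
Qed.
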